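(* Let $V_1,\dots,V_s$ be finite-dimensional $\Bbbk$-vector spaces and let $M\in S^{d_1}V_1\otimes\cdots\otimes S^{d_s}V_s$ be a (nonzero) multihomogeneous polynomial of multidegree $\mathbf{d}=(d_1,\dots,d_s)$. For $i=1,\dots,r$, let $P_i=(\ell_{i,1},\dots,\ell_{i,s})$ where each $\ell_{i,j}\in V_j$, $\ell_{i,j}\neq0$. Let $I=I([P_1],\dots,[P_r])\subset T$. Then $M\in\operatorname{span}(P_1^{\mathbf{d}},\dots,P_r^{\mathbf{d}})$ if and only if $I\subset M^\perp$. More generally, let $Z\subset\mathbb{P}V=\prod_{i=1}^s\mathbb{P}V_i$ be a (closed) subscheme with defining ideal $I=I(Z)\subset T$. Then $[M]$ is in the linear span of $\nu_{\mathbf{d}}(Z)$ if and only if $I\subset M^\perp$.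
   Context: $\Bbbk$ is an algebraically closed field of characteristic $0$. $S=\Bbbk[V_1\oplus\cdots\oplus V_s]$ is the polynomial ring on a union of bases of the $V_i$, and $T=\Bbbk[V_1^*\oplus\cdots\oplus V_s^*]$ the polynomial ring on the dual bases, both $\mathbb{Z}^s$-graded, with $S_{\mathbf{d}}=S^{d_1}V_1\otimes\cdots\otimes S^{d_s}V_s$. $T$ acts on $S$ by constant-coefficient differential operators (each dual basis element acting as the corresponding partial derivative), and $T$ is also the multigraded coordinate ring of $\mathbb{P}V=\mathbb{P}V_1\times\cdots\times\mathbb{P}V_s$, where $\mathbb{P}V_i$ is the space of lines in $V_i$. The apolar ideal of $M$ is $M^\perp=\{\Theta\in T:\Theta M=0\}$. For $P=(\ell_1,\dots,\ell_s)$ with $0\neq\ell_j\in V_j$, write $[P]=([\ell_1],\dots,[\ell_s])\in\prod\mathbb{P}V_j$ and $P^{\mathbf{d}}=\ell_1^{d_1}\cdots\ell_s^{d_s}\in S_{\mathbf{d}}$. $I([P_1],\dots,[P_r])$ is the ideal generated by all multihomogeneous elements of $T$ vanishing at all $[P_i]$; $I(Z)$ is the ideal generated by all multihomogeneous elements of $T$ vanishing on the scheme $Z$ (the saturated multihomogeneous defining ideal). $\nu_{\mathbf{d}}:\prod\mathbb{P}V_i\to\mathbb{P}(S^{d_1}V_1\otimes\cdots\otimes S^{d_s}V_s)$ is the Segre–Veronese map $\nu_{\mathbf{d}}([\ell_1],\dots,[\ell_s])=[\ell_1^{d_1}\cdots\ell_s^{d_s}]$. The linear span of a subscheme of projective space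 is the smallest linear subspace containing it as a subscheme, i.e. the common zero locus of all linear forms vanishing on it. *)

(* Defs.v *)
From HB Require Import structures.
From mathcomp Require Import all_boot all_order all_algebra.
From mathcomp Require Import ssrcomplements mpoly.

Set Implicit Arguments.
Unset Strict Implicit.
Unset Printing Implicit Defensive.

Import GRing.Theory.
Local Open Scope ring_scope.

(* {mpoly R[n]} is graded by s-tuples of naturals through a map               *)
(* c : 'I_n -> 'I_s sending each variable to the block it belongs to; it is   *)
(* then the coordinate ring of the product over i < s of the projective       *)
(* spaces with homogeneous coordinates { 'X_b | c b = i }.                    *)

Definition multideg n s (c : 'I_n -> 'I_s) (m : 'X_{1..n}) (i : 'I_s) : nat :=
  (\sum_(b < n | c b == i) m b)%N.

Definition multihomog (R : nzRingType) n s (c : 'I_n -> 'I_s)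
    (d : 'I_s -> nat) (p : {mpoly R[n]}) : Prop :=
  forall m, m \in msupp p -> forall i, multideg c m i = d i.

Definition is_ideal (R : nzRingType) (A : R -> Prop) : Prop :=
  [/\ A 0, (forall f g, A f -> A g -> A (f + g))
         & (forall a f, A f -> A (a * f))].

Definition ideal_gen (R : nzRingType) (G : R -> Prop) (f : R) : Prop :=
  exists (q : nat) (a g : 'I_q -> R),
    (forall i, G (g i)) /\ f = \sum_(i < q) a i * g i.

(* Constant-coefficient differential operators: 'X_b in the first argument    *)
(* acts as the partial derivative with respect to 'X_b.                       *)
Definition apply_diff (R : nzRingType) n (Theta M : {mpoly R[n]}) :
    {mpoly R[n]} :=
  \sum_(m <- msupp Theta) Theta@_m *: M^`M[m].

Definition apolar_ideal (R : nzRingType) n (M Theta : {mpoly R[n]}) : Prop :=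
  apply_diff Theta M = 0.

(* P^d, where P has its i-th component l_i = \sum_(c b = i) v b * 'X_b.       *)
Definition power_form (R : nzRingType) n s (c : 'I_n -> 'I_s)
    (d : 'I_s -> nat) (v : 'I_n -> R) : {mpoly R[n]} :=
  \prod_(i < s) (\sum_(b < n | c b == i) v b *: 'X_b) ^+ d i.

Section Subscheme.

Variables (k : fieldType) (n s : nat) (c : 'I_n -> 'I_s).

(* The standard affine charts: a chart J selects one coordinate J i in each   *)
(* block i, and is the open set where no 'X_(J i) vanishes.                   *)
Definition chart : finType :=
  {J : {ffun 'I_s -> 'I_n} | [forall i, c (J i) == i]}.

Definition chart_var (J : chart) (i : 'I_s) : {mpoly k[n]} := 'X_(val J i).

(* Closed subschemes of a product of projective spaces, as quasi-coherent     *)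
(* ideal sheaves.  The chart J is identified with the affine slice            *)
(* {'X_(J i) = 1 for all i}, whose coordinate ring is the quotient of         *)
(* {mpoly k[n]} by the polynomials 'X_(J i) - 1; an ideal of it is given by   *)
(* its preimage [chart_ideal J], an ideal of {mpoly k[n]} containing all the  *)
(* 'X_(J i) - 1.  A multihomogeneous F lies in [chart_ideal J] iff its        *)
(* dehomogenization in the chart J belongs to that ideal.  Every element of   *)
(* the quotient is the dehomogenization of such an F, and [chart_glue] says   *)
(* that the ideals of any two charts J, K have the same extension to the      *)
(* overlap: the part of J where x := \prod_i 'X_(K i) is invertible.          *)
Record closed_subscheme := ClosedSubscheme {
  chart_ideal : chart -> {mpoly k[n]} -> Prop;
  chart_ideal_ideal : forall J, is_ideal (chart_ideal J);
  chart_ideal_slice : forall J i, chart_ideal J (chart_var J i - 1);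
  chart_glue : forall (J K : chart) (e : 'I_s -> nat) (F : {mpoly k[n]}),
    multihomog c e F -> chart_ideal K F ->
    exists m : nat, chart_ideal J ((\prod_(i < s) chart_var K i) ^+ m * F)
}.

(* Meaningful for multihomogeneous F.                                         *)
Definition vanishes_on (Z : closed_subscheme) (F : {mpoly k[n]}) : Prop :=
  forall J, chart_ideal Z J F.

Definition scheme_ideal (Z : closed_subscheme) : {mpoly k[n]} -> Prop :=
  ideal_gen (fun F => (exists e, multihomog c e F) /\ vanishes_on Z F).

End Subscheme.

(* Points given by their homogeneous coordinates.                             *)
Definition points_ideal (k : fieldType) n s (c : 'I_n -> 'I_s) r
    (v : 'I_r -> 'I_n -> k) : {mpoly k[n]} -> Prop :=
  ideal_gen (fun F => (exists e, multihomog c e F) /\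
                      forall i, F.@[v i] = 0).

(* Projective N-1-space is the product with a single block.                   *)
Definition one_block N : 'I_N -> 'I_1 := fun=> ord0.

Definition in_linear_span (k : fieldType) N
    (Z : closed_subscheme k (@one_block N)) (v : 'I_N -> k) : Prop :=
  forall L : {mpoly k[N]}, multihomog (@one_block N) (fun=> 1%N) L ->
    vanishes_on Z L -> L.@[v] = 0.

Section SegreVeronese.

Variables (k : fieldType) (n s : nat) (c : 'I_n -> 'I_s) (d : 'I_s -> nat).

(* The monomials of multidegree d, a basis of the space S_d of forms of       *)
(* multidegree d; they index the homogeneous coordinates on its projective    *)
(* space.                                                                     *)
Definition monomials : finType :=
  {m : 'X_{1..n < (\sum_(i < s) d i).+1}
     | [forall i, multideg c (val m) i == d i]}.

Definition dimSd : nat := #|monomials|.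

Definition Sd_mon (a : 'I_dimSd) : 'X_{1..n} := val (val (enum_val a)).

Definition Sd_coord (M : {mpoly k[n]}) (a : 'I_dimSd) : k := M@_(Sd_mon a).

(* The homogeneous components of the Segre-Veronese map [P] |-> [P^d]: the    *)
(* coordinates of P^d at the generic point P, whose coordinates are the       *)
(* variables of {mpoly k[n]}.                                                 *)
Definition segre_veronese (a : 'I_dimSd) : {mpoly k[n]} :=
  (power_form c d (fun b : 'I_n => 'X_b : {mpoly k[n]}))@_(Sd_mon a).

Local Notation nu := segre_veronese.

(* nu_a ^ m * g (nu / nu_a), a polynomial as soon as g has degree <= m.       *)
Definition sv_pull (a : 'I_dimSd) (m : nat) (g : {mpoly k[dimSd]}) :
    {mpoly k[n]} :=
  \sum_(u <- msupp g)
    g@_u *: (nu a ^+ (m - mdeg u) * \prod_(b < dimSd) nu b ^+ u b).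

(* Ideal, in the chart J of the projective space of S_d (the slice where the  *)
(* coordinate a := J 0 is 1), of the scheme-theoretic image of Z: the g whose *)
(* pullback g (nu / nu_a) vanishes on the part of Z where nu_a is invertible, *)
(* that is, lies in the extension of [chart_ideal Z K] to the localization    *)
(* at nu_a, for every chart K.                                                *)
Definition sv_image_ideal (Z : closed_subscheme k c)
    (J : chart (@one_block dimSd)) (g : {mpoly k[dimSd]}) : Prop :=
  forall K : chart c, exists m : nat,
    (msize g <= m.+1)%N /\ chart_ideal Z K (sv_pull (val J ord0) m g).

(* Helpers showing that these ideals form a closed subscheme; sv_pullw is a   *)
(* version of sv_pull that is linear in g.                                    *)
Definition sv_mon (a : 'I_dimSd) m (u : 'X_{1..dimSd}) : {mpoly k[n]} :=
  nu a ^+ (m - mdeg u) * \prod_(b < dimSd) nu b ^+ u b.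

Definition sv_pullw a m (g : {mpoly k[dimSd]}) : {mpoly k[n]} :=
  \sum_(u : 'X_{1..dimSd < m.+1}) g@_u *: sv_mon a m u.

Lemma sv_pullwE a m g :
  (msize g <= m.+1)%N -> sv_pull a m g = sv_pullw a m g.
Proof.
move=> sz; rewrite /sv_pull /sv_pullw (big_mksub 'X_{1..dimSd < m.+1}) //=.
- by rewrite big_rmcond //= => u /memN_msupp_eq0 ->; rewrite scale0r.
- exact: msupp_uniq.
- by move=> u /msize_mdeg_lt/leq_trans; apply.
Qed.

Lemma sv_pullwD a m f g :
  sv_pullw a m (f + g) = sv_pullw a m f + sv_pullw a m g.
Proof.
by rewrite -big_split /=; apply: eq_bigr => u _; rewrite mcoeffD scalerDl.
Qed.

Lemma sv_pullwZ a m x g :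
  sv_pullw a m (x *: g) = x *: sv_pullw a m g.
Proof.
by rewrite scaler_sumr; apply: eq_bigr => u _; rewrite mcoeffZ scalerA.
Qed.

Lemma sv_pullwX a m u :
  (mdeg u <= m)%N -> sv_pullw a m 'X_[u] = sv_mon a m u.
Proof.
move=> le; rewrite /sv_pullw (bigD1 (BMultinom (le : mdeg u < m.+1)%N)) //=.
rewrite mcoeffX eqxx scale1r big1 ?addr0 // => v /negbTE.
by rewrite -val_eqE /= eq_sym => nv; rewrite mcoeffX nv scale0r.
Qed.

Lemma sv_pullw_sum a m (I : Type) (r : seq I) (F : I -> {mpoly k[dimSd]}) :
  sv_pullw a m (\sum_(i <- r) F i) = \sum_(i <- r) sv_pullw a m (F i).
Proof.
elim: r => [|i r IH]; last by rewrite !big_cons sv_pullwD IH.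
by rewrite !big_nil /sv_pullw big1 // => u _; rewrite mcoeff0 scale0r.
Qed.

Lemma sv_monD a m p u v : (mdeg u <= m)%N -> (mdeg v <= p)%N ->
  sv_mon a (m + p) (u + v)%MM = sv_mon a m u * sv_mon a p v.
Proof.
move=> lu lv; rewrite /sv_mon mdegD.
have -> : (m + p - (mdeg u + mdeg v) = m - mdeg u + (p - mdeg v))%N.
  by rewrite subnDA -addnBAC // addnBA.
rewrite exprD mulrACA -big_split /=; congr (_ * _).
by apply: eq_bigr => b _; rewrite mnmDE exprD.
Qed.

Lemma sv_pullwMX a m p u g : (msize g <= m.+1)%N -> (mdeg u <= p)%N ->
  sv_pullw a (p + m) ('X_[u] * g) = sv_mon a p u * sv_pullw a m g.
Proof.
move=> sz le; rewrite [in LHS](mpolyE g) mulr_sumr sv_pullw_sum.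
rewrite -[sv_pullw a m g]sv_pullwE // /sv_pull mulr_sumr.
rewrite big_seq [RHS]big_seq; apply: eq_bigr => v /msize_mdeg_lt lv.
have {}lv : (mdeg v <= m)%N by rewrite -ltnS (leq_trans lv).
rewrite -scalerAr -mpolyXD sv_pullwZ sv_pullwX ?mdegD ?leq_add // sv_monD //.
by rewrite -scalerAr.
Qed.

Lemma msizeMX_leq p m u (g : {mpoly k[dimSd]}) : (msize g <= m.+1)%N ->
  (mdeg u <= p)%N -> (msize ('X_[u] * g) <= (p + m).+1)%N.
Proof.
move=> sz le; have [->|nz] := eqVneq g 0; first by rewrite mulr0 msize0.
have nX : 'X_[u] != 0 :> {mpoly k[dimSd]} by rewrite -msize_poly_eq0 msizeX.
rewrite (msizeM nX nz) msizeX addSn /=.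
by rewrite -addnS leq_add.
Qed.

Section Image.

Variable Z : closed_subscheme k c.

Lemma sv_image_idealP J g :
  sv_image_ideal Z J g <->
  forall K : chart c, exists m : nat,
    (msize g <= m.+1)%N /\ chart_ideal Z K (sv_pullw (val J ord0) m g).
Proof.
split=> H K; have [m [sz Hm]] := H K; exists m; split=> //.
  by rewrite -sv_pullwE.
by rewrite sv_pullwE.
Qed.

Lemma sv_pullw_raise K a m p g : (msize g <= m.+1)%N ->
  chart_ideal Z K (sv_pullw a m g) -> chart_ideal Z K (sv_pullw a (p + m) g).
Proof.
move=> sz H; have := @sv_pullwMX a m p 0%MM g sz.
rewrite mpolyX0 mul1r mdeg0 => -> //.
by have [_ _] := chart_ideal_ideal Z K; apply.
Qed.

Lemma sv_image_is_ideal J : is_ideal (sv_image_ideal Z J).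
Proof.
set a := val J ord0.
have addI f g : sv_image_ideal Z J f -> sv_image_ideal Z J g ->
    sv_image_ideal Z J (f + g).
  move=> /sv_image_idealP Hf /sv_image_idealP Hg; apply/sv_image_idealP => K.
  have [m [sf If]] := Hf K; have [p [sg Ig]] := Hg K.
  exists (p + m)%N; split.
    apply: leq_trans (msizeD_le _ _) _.
    rewrite geq_max (leq_trans sf) ?ltnS ?leq_addl //.
    by rewrite (leq_trans sg) // ltnS leq_addr.
  have [_ addZ _] := chart_ideal_ideal Z K.
  rewrite sv_pullwD; apply: addZ; first exact: sv_pullw_raise.
  by rewrite addnC; apply: sv_pullw_raise.
have I0 : sv_image_ideal Z J 0.
  move=> K; exists 0%N; rewrite msize0; split=> //.
  rewrite /sv_pull msupp0 big_nil.
  by have [] := chart_ideal_ideal Z K.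
split=> // f g Ig; elim/mpolyind: f => [|x u f _ _ IH]; first by rewrite mul0r.
rewrite mulrDl; apply: addI => //; apply/sv_image_idealP => K.
have /sv_image_idealP/(_ K) [m [sz Im]] := Ig.
exists (mdeg u + m)%N; split.
  by rewrite -scalerAl (leq_trans (msizeZ_le _ _)) // msizeMX_leq.
rewrite -scalerAl sv_pullwZ sv_pullwMX //.
have [_ _ mulZ] := chart_ideal_ideal Z K.
by rewrite -mul_mpolyC; do 2!apply: (mulZ).
Qed.

Lemma sv_image_slice J i : sv_image_ideal Z J (chart_var k J i - 1).
Proof.
rewrite ord1; apply/sv_image_idealP => K; exists 1%N; split.
  apply: leq_trans (msizeD_le _ _) _.
  by rewrite msizeN msize1 geq_max msizeX mdeg1.
rewrite sv_pullwD -scaleN1r sv_pullwZ -mpolyX0 !sv_pullwX ?mdeg0 ?mdeg1 //.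
have [Z0 _ _] := chart_ideal_ideal Z K.
rewrite /sv_mon mdeg0 mdeg1 subnn subn0 expr0 mul1r expr1.
rewrite (bigD1 (val J ord0)) //= mnm1E eqxx expr1 big1 ?mulr1; last first.
  by move=> b nb; rewrite mnm1E eq_sym (negbTE nb) expr0.
rewrite big1 ?mulr1 ?scaleN1r ?subrr // => b _.
by rewrite mnm0E expr0.
Qed.

Lemma sv_image_glue (J K : chart (@one_block dimSd)) e (F : {mpoly k[dimSd]}) :
  multihomog (@one_block dimSd) e F -> sv_image_ideal Z K F ->
  exists m : nat,
    sv_image_ideal Z J ((\prod_(i < 1) chart_var k K i) ^+ m * F).
Proof.
move=> hF /sv_image_idealP H; rewrite big_ord1 /chart_var.
set a := val J ord0; set b := val K ord0.
have degF u : u \in msupp F -> mdeg u = e ord0.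
  move=> /hF/(_ ord0) <-; rewrite /multideg mdegE.
  by apply: eq_bigl => v; rewrite /one_block eqxx.
have szF : (msize F <= (e ord0).+1)%N.
  rewrite msizeE big_seq; apply/bigmax_leqP_seq => u; rewrite ?andbT.
  by move=> /[swap] _ /degF ->.
have [m Hm] := fin_all_exists (fun L => H L).
exists (\max_L m L)%N; apply/sv_image_idealP => L.
have [sz IL] := Hm L.
have le : (m L <= \max_L m L)%N by exact: leq_bigmax.
rewrite mpolyXn; set M := (\max_L m L)%N in le *.
exists (M + e ord0)%N; rewrite msizeMX_leq ?mdegMn ?mdeg1 ?mul1n //; split=> //.
rewrite sv_pullwMX ?mdegMn ?mdeg1 ?mul1n //.
rewrite /sv_mon mdegMn mdeg1 mul1n subnn expr0 mul1r.
rewrite (bigD1 b) //= mulmnE mnm1E eqxx mul1n big1 ?mulr1; last first.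
  by move=> v nv; rewrite mulmnE mnm1E eq_sym (negbTE nv) expr0.
have -> : nu b ^+ M * sv_pullw a (e ord0) F =
    nu b ^+ e ord0 * (nu b ^+ (M - m L) * sv_pullw b (m L) F).
  rewrite -[sv_pullw a _ _]sv_pullwE // -[sv_pullw b _ _]sv_pullwE // /sv_pull.
  rewrite mulrA -exprD !mulr_sumr big_seq [RHS]big_seq.
  apply: eq_bigr => u uF; rewrite !scalerAr -!scalerAr; congr (_ *: _).
  have leu : (e ord0 <= m L)%N.
    by rewrite -(degF _ uF) -ltnS (leq_trans (msize_mdeg_lt uF)).
  rewrite (degF _ uF) subnn expr0 mul1r mulrA -exprD; congr (_ ^+ _ * _).
  by rewrite -addnA addnC -addnA subnK // subnK.
have [_ _ mulZ] := chart_ideal_ideal Z L.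
by do 2!apply: (mulZ).
Qed.

(* The scheme-theoretic image of Z under the Segre-Veronese map.              *)
Definition sv_image : closed_subscheme k (@one_block dimSd) :=
  ClosedSubscheme sv_image_is_ideal sv_image_slice sv_image_glue.

End Image.
End SegreVeronese.

(* The variables: pairs (i, j) standing for the j-th vector of the chosen     *)
(* basis of V i.  As an element of S, the variable (i, j) is this basis       *)
(* vector; as an element of T, it is its dual.                                *)
Section Coordinates.

Variables (k : fieldType) (s : nat) (V : 'I_s -> vectType k).

Definition var_pair : finType := {i : 'I_s & 'I_(\dim {:V i})}.

Definition nvars : nat := #|var_pair|.

Definition var_block (b : 'I_nvars) : 'I_s := tag (enum_val b : var_pair).

(* Homogeneous coordinates of ([l_1], ..., [l_s]) in given bases of the V i.  *)
Definition point_coord (B : forall i, (\dim {:V i}).-tuple (V i))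
    (l : forall i, V i) (b : 'I_nvars) : k :=
  coord (B (var_block b)) (tagged (enum_val b : var_pair)) (l (var_block b)).

End Coordinates.

(* Main.v *)
Require Import Defs.
From HB Require Import structures.
From mathcomp Require Import all_boot all_order all_algebra.
From mathcomp Require Import mpoly.

Set Implicit Arguments.
Unset Strict Implicit.
Unset Printing Implicit Defensive.

Import GRing.Theory.
Local Open Scope ring_scope.

(** Write <F, M> for the pairing of F in T with M in S under which distinct
    monomials are orthogonal and <X^m, X^m> = m!; it is the constant term of
    F M.  Up to the factor u!, which is invertible in characteristic 0, the
    coefficient of X^u in Theta M is <X^u Theta, M>.  Since M is
    multihomogeneous of multidegree d, the pairing only sees the component of
    multidegree d of its first argument.  Hence an ideal generated by a set of
    multihomogeneous forms closed under multiplication by monomials lies in the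
    apolar ideal of M iff every generator F of multidegree d satisfies
    <F, M> = 0 ([ideal_gen_apolarP]).  Both halves of the theorem reduce to this
    one degree.

    For points, the coefficients of P^d ([power_form_coef]) give
    <F, P^d> = d! F(P) ([pairing_power_form]).  So the forms F of multidegree d
    vanishing at the P_i are the orthogonal of the span of the P_i^d, and by
    duality in finite dimension M is in the span iff M is orthogonal to all of
    them ([span_power_formP]).

    For a subscheme Z, substituting the components nu_b of the Segre-Veronese
    map for the coordinates maps the linear forms L on the projective space of
    S_d onto the forms L(nu) of multidegree d, and <L(nu), M> = d! L(M)
    ([pairing_linear_pull], [linear_pull_onto]).  It remains to see that L
    vanishes on the scheme-theoretic image of Z iff L(nu) vanishes on Z
    ([vanishes_on_sv_image]).  Vanishing on the image only says that, on each
    chart, nu_a^m L(nu) vanishes on Z for each a and some m; but on the chart of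
    the product where the coordinates x_i are set to 1, the component nu_a of
    the monomial \prod_i x_i^(d_i) is a nonzero constant, so that nothing is
    lost there ([linear_span_sv_imageP]). *)

(** * Monomials and multidegrees *)

Definition mnm_fact n (m : 'X_{1..n}) : nat := (\prod_(b < n) (m b)`!)%N.

Lemma mnm_factDU n (m : 'X_{1..n}) b :
  mnm_fact (m + U_(b)) = ((m b).+1 * mnm_fact m)%N.
Proof.
rewrite /mnm_fact (bigD1 b) //= [in RHS](bigD1 b) //= mulnA -factS.
rewrite mnmDE mnm1E eqxx addn1; congr (_ * _)%N; apply: eq_bigr => e neb.
by rewrite mnmDE mnm1E eq_sym (negbTE neb) addn0.
Qed.

Lemma multidegD n s (c : 'I_n -> 'I_s) (m p : 'X_{1..n}) i :
  multideg c (m + p) i = (multideg c m i + multideg c p i)%N.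
Proof. by rewrite -big_split /=; apply: eq_bigr => b _; rewrite mnmDE. Qed.

Lemma multideg0 n s (c : 'I_n -> 'I_s) i : multideg c 0%MM i = 0%N.
Proof. by apply: big1 => b _; rewrite mnm0E. Qed.

Lemma multidegU n s (c : 'I_n -> 'I_s) b i :
  multideg c U_(b)%MM i = (c b == i).
Proof.
rewrite /multideg big_mkcond (bigD1 b) //= mnm1E eqxx big1 => [|e neb].
  by rewrite addn0; case: (c b == i).
by rewrite mnm1E (eq_sym b) (negbTE neb) if_same.
Qed.

Lemma mdeg_multideg n s (c : 'I_n -> 'I_s) (m : 'X_{1..n}) :
  mdeg m = (\sum_(i < s) multideg c m i)%N.
Proof. by rewrite mdegE (partition_big c predT) //; apply: eq_bigr. Qed.

Lemma multihomogXM (R : comNzRingType) n s (c : 'I_n -> 'I_s) e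
    (F : {mpoly R[n]}) u :
  multihomog c e F ->
  multihomog c (fun i => multideg c u i + e i)%N ('X_[u] * F).
Proof.
move=> hF m; rewrite mulrC (perm_mem (msuppMX F u)) => /mapP[p pF ->] i.
by rewrite multidegD (hF _ pF).
Qed.

Lemma multihomog_lincomb (R : nzRingType) n s (c : 'I_n -> 'I_s) d
    (I : Type) (r : seq I) (a : I -> R) (F : I -> {mpoly R[n]}) :
  (forall i, multihomog c d (F i)) ->
  multihomog c d (\sum_(i <- r) a i *: F i).
Proof.
move=> hF m; rewrite mcoeff_msupp => nz.
have [i mFi] : exists i, m \in msupp (F i).
  move: nz; rewrite raddf_sum /=; elim: r => [|i r IH].
    by rewrite big_nil eqxx.
  rewrite big_cons mcoeffZ.
  have [|/memN_msupp_eq0->] := boolP (m \in msupp (F i)); first by exists i.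
  by rewrite mulr0 add0r.
exact: hF mFi.
Qed.

(** * The coefficients of a product of powers of linear forms *)

Section PowerForms.

Variables (R : comNzRingType) (n s : nat) (c : 'I_n -> 'I_s).

Lemma mderivXn b (p : {mpoly R[n]}) e :
  (p ^+ e)^`M(b) = e%:R *: (p ^+ e.-1 * p^`M(b)).
Proof.
elim: e => [|e IH]; first by rewrite expr0 -mpolyC1 mderivC scale0r.
rewrite exprS mderivM IH -scalerAr mulrA; case: e {IH} => [|e].
  by rewrite scale0r addr0 expr0 mulr1 mul1r scale1r.
by rewrite /= -exprS mulrC -[X in X + _]scale1r -scalerDl addrC natr1.
Qed.

Lemma mderiv_power_form d (v : 'I_n -> R) b :
  (power_form c d v)^`M(b) =
  ((d (c b))%:R * v b) *: power_form c (fun i => d i - (i == c b))%N v.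
Proof.
pose L i : {mpoly R[n]} := \sum_(e < n | c e == i) v e *: 'X_e.
have dL i : (L i)^`M(b) = if i == c b then (v b)%:MP else 0.
  rewrite /L raddf_sum /= big_mkcond (bigD1 b) //= big1 => [|e neb].
    rewrite addr0 eq_sym; case: eqP => // _.
    rewrite mderivZ mderivX mnm1E eqxx -{1}[U_(b)%MM]add0m addmK mpolyX0.
    by rewrite scale1r -alg_mpolyC.
  rewrite mderivZ mderivX mnm1E (negbTE neb) scale0r scaler0.
  by rewrite if_same.
rewrite /power_form -/(L _) (bigD1 (c b)) //= mderivM.
rewrite [in RHS](bigD1 (c b)) //= -/(L _) mderivXn dL eqxx subn1.
set Q := \prod_(i < s | i != c b) _.
have -> : Q^`M(b) = 0.
  rewrite /Q; elim/big_ind: _ => [|x y hx hy|i ni].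
  - by rewrite -mpolyC1 mderivC.
  - by rewrite mderivM hx hy mul0r mulr0 addr0.
  - by rewrite mderivXn dL (negbTE ni) mulr0 scaler0.
rewrite mulr0 addr0 [_ * (v b)%:MP]mulrC mul_mpolyC scalerA -scalerAl.
congr (_ *: (_ * _)); apply: eq_bigr => i ni.
by rewrite (negbTE ni) subn0.
Qed.

(** The multinomial theorem, in all blocks at once.  It is stated without
    division because it is used both over the base field and for the generic
    point, whose coordinates are polynomials.  The proof is by induction on m:
    differentiating with respect to 'X_b lowers m by U_(b) and P^d to the
    product of the same linear forms in multidegree d - e_(c b). *)
Lemma power_form_coef d (v : 'I_n -> R) (m : 'X_{1..n}) :
  (mnm_fact m)%:R * (power_form c d v)@_m =
  if [forall i, multideg c m i == d i]
  then (\prod_(i < s) (d i)`!)%:R * \prod_(b < n) v b ^+ m b else 0.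
Proof.
have [N] := ubnP (mdeg m); elim: N => // N IH in d m *; rewrite ltnS => leN.
have [->|nz] := eqVneq m 0%MM.
  rewrite {1}/mnm_fact big1 ?mul1r => [|b _]; last by rewrite mnm0E.
  rewrite /power_form rmorph_prod /= [X in _ * X]big1 => [|b _]; last first.
    by rewrite mnm0E.
  have L0 i : (\sum_(b < n | c b == i) v b *: 'X_b : {mpoly R[n]})@_0%MM = 0.
    rewrite raddf_sum /= big1 // => b _.
    by rewrite mcoeffZ mcoeffX mnm1_eq0 mulr0.
  rewrite mulr1; case: forallP => [d0|nd0].
    rewrite !big1 // => i _; have := d0 i; rewrite multideg0 => /eqP <- //.
    by rewrite expr0 mcoeff1 eqxx.
  have [i di] : exists i, d i != 0%N.
    apply/existsP; rewrite -negb_forall; apply/forallP => dd.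
    by case: nd0 => i; rewrite multideg0 eq_sym.
  rewrite (bigD1 i) //= rmorphXn /= L0 -[d i]prednK ?lt0n //.
  by rewrite exprS !mul0r.
have [b mb] : exists b, m b != 0%N.
  apply/existsP; rewrite -negb_forall; apply: contraNN nz => /forallP m0.
  by apply/eqP/mnmP => b; rewrite mnm0E; apply/eqP.
have {nz mb} [p mE] : exists p, m = (p + U_(b))%MM.
  exists (m - U_(b))%MM; rewrite submK //; apply/mnm_lepP => e.
  by rewrite mnm1E; case: eqP => [<-|//]; rewrite lt0n.
move: leN; rewrite {}mE mdegD mdeg1 addn1 => leN.
have -> : (mnm_fact (p + U_(b)))%:R * (power_form c d v)@_(p + U_(b)) =
    (mnm_fact p)%:R * ((power_form c d v)^`M(b))@_p.
  rewrite mcoeff_mderiv mnm_factDU mulnC natrM -mulrA.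
  by congr (_ * _); rewrite mulr_natl.
rewrite mderiv_power_form mcoeffZ mulrCA IH //.
have [d0|dpos] := posnP (d (c b)).
  rewrite d0 !mul0r; case: forallP => // /(_ (c b)).
  by rewrite multidegD multidegU eqxx addn1 d0.
have -> : [forall i, multideg c (p + U_(b)) i == d i] =
          [forall i, multideg c p i == (d i - (i == c b))%N].
  apply: eq_forallb => i; rewrite multidegD multidegU [i == c b]eq_sym.
  case: (c b =P i) => [<-|_]; last by rewrite addn0 subn0.
  by rewrite -[d (c b)]prednK // addn1 subn1 eqSS.
case: ifP => _; last by rewrite mulr0.
rewrite [in RHS](bigD1 (c b)) //= [in LHS](bigD1 (c b)) //= eqxx subn1.
rewrite (eq_bigr (fun i => (d i)`!)) => [|i ni]; last first.
  by rewrite (negbTE ni) subn0.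
rewrite -[X in _ = (X`! * _)%:R * _]prednK // factS prednK //.
rewrite [in RHS](bigD1 b) //= [in LHS](bigD1 b) //= mnmDE mnm1E eqxx addn1.
rewrite [in RHS](eq_bigr (fun e => v e ^+ p e)) => [|e ne]; last first.
  by rewrite mnmDE mnm1E eq_sym (negbTE ne) addn0.
by rewrite exprS !natrM mulrACA !mulrA.
Qed.

End PowerForms.

(** * The monomial basis of the forms of multidegree d *)

Section Monomials.

Variables (n s : nat) (c : 'I_n -> 'I_s) (d : 'I_s -> nat).

Lemma multideg_Sd_mon (a : 'I_(dimSd c d)) i : multideg c (Sd_mon a) i = d i.
Proof. by apply/eqP; have /forallP := valP (enum_val a); apply. Qed.

Lemma Sd_mon_inj : injective (@Sd_mon n s c d).
Proof. by move=> a b /val_inj/val_inj/enum_val_inj. Qed.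

Lemma Sd_monP (m : 'X_{1..n}) :
  (forall i, multideg c m i = d i) -> exists a : 'I_(dimSd c d), Sd_mon a = m.
Proof.
move=> dm; have lt_m : (mdeg m < (\sum_(i < s) d i).+1)%N.
  by rewrite (mdeg_multideg c) ltnS leq_sum // => i _; rewrite dm.
have Pm : [forall i, multideg c (val (BMultinom lt_m)) i == d i].
  by apply/forallP => i; apply/eqP/dm.
exists (enum_rank (Sub (BMultinom lt_m) Pm : monomials c d)).
by rewrite /Sd_mon enum_rankK.
Qed.

(** Turns the sums over a support, in which evaluation and differential
    operators are expressed, into sums over the monomial basis. *)
Lemma big_msupp_Sd (R : nzRingType) (F : {mpoly R[n]}) (g : 'X_{1..n} -> R) :
  (forall m, m \in msupp F -> g m != 0 -> forall i, multideg c m i = d i) ->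
  \sum_(m <- msupp F) F@_m * g m =
  \sum_(a < dimSd c d) F@_(Sd_mon a) * g (Sd_mon a).
Proof.
move=> dg; pose h m := F@_m * g m.
have nz_sum r : \sum_(m <- r) h m = \sum_(m <- [seq m <- r | h m != 0]) h m.
  rewrite big_filter [RHS]big_mkcond; apply: eq_bigr => m _.
  by case: eqP => // ->.
rewrite -/(h _) -[RHS](big_map (@Sd_mon n s c d) xpredT h) nz_sum [RHS]nz_sum.
apply: perm_big; apply: uniq_perm.
- by rewrite filter_uniq // msupp_uniq.
- rewrite filter_uniq // map_inj_uniq ?index_enum_uniq //; exact: Sd_mon_inj.
move=> m; rewrite !mem_filter; case: eqP => //= /eqP hm.
have mF : m \in msupp F.
  rewrite mcoeff_msupp; apply: contraNneq hm; rewrite /h => ->.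
  by rewrite mul0r.
have gm : g m != 0.
  by apply: contraNneq hm; rewrite /h => ->; rewrite mulr0.
have [a am] := Sd_monP (dg m mF gm); rewrite mF -am.
by rewrite map_f // mem_index_enum.
Qed.

Section FormOf.

Variables (R : nzRingType) (w : 'I_(dimSd c d) -> R).

Definition form_of : {mpoly R[n]} :=
  \sum_(a < dimSd c d) w a *: 'X_[Sd_mon a].

Lemma form_of_coef a : form_of@_(Sd_mon a) = w a.
Proof.
rewrite /form_of raddf_sum /= (bigD1 a) //= mcoeffZ mcoeffX eqxx mulr1.
rewrite big1 ?addr0 // => b nb; rewrite mcoeffZ mcoeffX.
by rewrite (inj_eq Sd_mon_inj) (negbTE nb) mulr0.
Qed.

Lemma form_of_homog : multihomog c d form_of.
Proof.
move=> m; rewrite mcoeff_msupp => nz i.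
case: (pickP (fun a : 'I_(dimSd c d) => Sd_mon a == m)) => [a /eqP <-|none].
  exact: multideg_Sd_mon.
case/eqP: nz; rewrite /form_of raddf_sum big1 //= => a _.
by rewrite mcoeffZ mcoeffX none mulr0.
Qed.

End FormOf.

Lemma eq_homog (R : nzRingType) (F G : {mpoly R[n]}) :
  multihomog c d F -> multihomog c d G ->
  (forall a : 'I_(dimSd c d), F@_(Sd_mon a) = G@_(Sd_mon a)) -> F = G.
Proof.
move=> hF hG eqFG; apply/mpolyP => m.
case: (pickP (fun a : 'I_(dimSd c d) => Sd_mon a == m)) => [a /eqP <- //|none].
have coef0 (H : {mpoly R[n]}) : multihomog c d H -> H@_m = 0.
  move=> hH.
  have [/hH/Sd_monP[a am]|/memN_msupp_eq0//] := boolP (m \in msupp H).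
  by have := none a; rewrite am eqxx.
by rewrite !coef0.
Qed.

End Monomials.

(** * The apolarity pairing *)

Section Pairing.

Variables (k : fieldType) (n s : nat) (c : 'I_n -> 'I_s) (d : 'I_s -> nat).
Local Notation mon := (@Sd_mon n s c d).

(** Summing over the monomials of multidegree d only, rather than over a
    support, makes the pairing bilinear by construction. *)
Definition pairing (F M : {mpoly k[n]}) : k :=
  \sum_(a < dimSd c d) F@_(mon a) * (M@_(mon a) * (mnm_fact (mon a))%:R).

Lemma pairing_suml (I : Type) (r : seq I) (F : I -> {mpoly k[n]}) M :
  pairing (\sum_(i <- r) F i) M = \sum_(i <- r) pairing (F i) M.
Proof.
rewrite /pairing [RHS]exchange_big; apply: eq_bigr => a _.
by rewrite raddf_sum mulr_suml.
Qed.

Lemma pairingZl x F M : pairing (x *: F) M = x * pairing F M.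
Proof.
rewrite /pairing mulr_sumr; apply: eq_bigr => a _.
by rewrite mcoeffZ -mulrA.
Qed.

Lemma pairing_lincombr (I : Type) (r : seq I) x F (M : I -> {mpoly k[n]}) :
  pairing F (\sum_(i <- r) x i *: M i) = \sum_(i <- r) x i * pairing F (M i).
Proof.
rewrite /pairing; under [RHS]eq_bigr do rewrite mulr_sumr.
rewrite [RHS]exchange_big; apply: eq_bigr => a _.
rewrite raddf_sum mulr_suml mulr_sumr; apply: eq_bigr => i _ /=.
by rewrite mcoeffZ -mulrA mulrCA.
Qed.

Lemma pairing_homog_neq e F M i :
  multihomog c e F -> e i != d i -> pairing F M = 0.
Proof.
move=> hF ned; apply: big1 => a _.
have [/hF/(_ i)|/memN_msupp_eq0->] := boolP (mon a \in msupp F).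
  by rewrite multideg_Sd_mon => de; rewrite de eqxx in ned.
by rewrite mul0r.
Qed.

Lemma pairing_power_form F v :
  multihomog c d F ->
  pairing F (power_form c d v) = (\prod_(i < s) (d i)`!)%:R * F.@[v].
Proof.
move=> hF; rewrite mevalE (big_msupp_Sd (c := c) (d := d)); last first.
  by move=> m mF _; apply: hF.
rewrite mulr_sumr; apply: eq_bigr => a _.
rewrite [_ * (mnm_fact _)%:R]mulrC power_form_coef.
have -> : [forall i, multideg c (mon a) i == d i].
  by apply/forallP => i; rewrite multideg_Sd_mon.
exact: mulrCA.
Qed.

(** The constant term of X^u (Theta M) is u! times the coefficient of X^u in
    Theta M, and X^u (Theta M) = (X^u Theta) M. *)
Lemma mcoeff_apply_diff Theta M u :
  multihomog c d M ->
  (mnm_fact u)%:R * (apply_diff Theta M)@_u = pairing ('X_[u] * Theta) M.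
Proof.
move=> hM; rewrite /pairing.
rewrite -(big_msupp_Sd (g := fun m => M@_m * (mnm_fact m)%:R)); last first.
  move=> m _ nz; apply: hM; rewrite mcoeff_msupp.
  by apply: contraNneq nz => ->; rewrite mul0r.
rewrite [LHS]mulrC ['X_[u] * _]mulrC (perm_big _ (msuppMX Theta u)).
rewrite big_map /apply_diff raddf_sum /= mulr_suml; apply: eq_bigr => m _.
rewrite mcoeffZ mcoeff_mderivm [(u + m)%MM]addmC.
have -> : mnm_fact (m + u) =
    (\prod_(b < n) ((m + u)%MM b) ^_ (m b) * mnm_fact u)%N.
  rewrite /mnm_fact -big_split; apply: eq_bigr => b _ /=.
  by rewrite mnmDE -(ffact_fact (leq_addr (u b) (m b))) addKn.
have -> : (Theta * 'X_[u])@_(m + u) = Theta@_m by rewrite addmC mcoeffMX.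
by rewrite natrM -mulrA -(mulr_natr (M@_ _)) !mulrA.
Qed.

End Pairing.

Section CharZero.

Variables (k : fieldType) (char0 : [pchar k] =i pred0).
Variables (n s : nat) (c : 'I_n -> 'I_s) (d : 'I_s -> nat).
Local Notation mon := (@Sd_mon n s c d).

Lemma natr_prod_fact_neq0 N (e : 'I_N -> nat) :
  (\prod_(i < N) (e i)`!)%:R != 0 :> k.
Proof.
rewrite ((pcharf0P k).1 char0) -lt0n prodn_gt0 // => i; exact: fact_gt0.
Qed.

Lemma apolar_pairingP (M Theta : {mpoly k[n]}) :
  multihomog c d M ->
  apolar_ideal M Theta <->
  (forall u, pairing c d ('X_[u] * Theta) M = 0).
Proof.
move=> hM; split=> [ap u|H].
  by rewrite -mcoeff_apply_diff // ap mcoeff0 mulr0.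
apply/mpolyP => u; rewrite mcoeff0.
have := H u; rewrite -mcoeff_apply_diff // => /eqP.
by rewrite mulf_eq0 (negbTE (natr_prod_fact_neq0 _)) => /eqP.
Qed.

(** By [apolar_pairingP] the condition on the left is <f, M> = 0 for all f of
    the ideal.  Such an f is a linear combination of multihomogeneous elements
    X^u g with g in G; they are again in G, and those whose multidegree is not
    d are orthogonal to M anyway. *)
Lemma ideal_gen_apolarP (G : {mpoly k[n]} -> Prop) M :
  multihomog c d M ->
  (forall F, G F -> exists e, multihomog c e F) ->
  (forall F u, G F -> G ('X_[u] * F)) ->
  (forall Theta, ideal_gen G Theta -> apolar_ideal M Theta) <->
  (forall F, multihomog c d F -> G F -> pairing c d F M = 0).
Proof.
move=> hM Ghom GX; split=> [H F hF GF|H Theta [q [a [g [Gg ->]]]]].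
  have /(apolar_pairingP _ hM)/(_ 0%MM) : apolar_ideal M F.
    apply: H; exists 1%N, (fun=> 1), (fun=> F); split=> //.
    by rewrite big_ord1 mul1r.
  by rewrite mpolyX0 mul1r.
have GX0 F u : G F -> pairing c d ('X_[u] * F) M = 0.
  move=> GF; have [e he] := Ghom _ (GX _ u GF).
  have [ed|/forallPn[i ned]] := boolP [forall i, e i == d i].
    apply: (H _ _ (GX _ u GF)) => m mF i.
    by rewrite (he m mF); apply/eqP/(forallP ed).
  exact: pairing_homog_neq he ned.
apply/(apolar_pairingP _ hM) => u; rewrite mulr_sumr pairing_suml.
apply: big1 => i _; rewrite [a i]mpolyE mulr_suml mulr_sumr pairing_suml.
apply: big1 => w _; rewrite -scalerAl -scalerAr mulrA -mpolyXD pairingZl.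
by rewrite GX0 // mulr0.
Qed.

End CharZero.

(** * Spans of powers *)

Section Apolarity.

Variables (k : fieldType) (char0 : [pchar k] =i pred0).
Variables (n s : nat) (c : 'I_n -> 'I_s) (d : 'I_s -> nat).
Local Notation mon := (@Sd_mon n s c d).
Local Notation dfact := (\prod_(i < s) (d i)`!)%N.

Lemma power_form_homog v : multihomog c d (power_form c d v : {mpoly k[n]}).
Proof.
move=> m; rewrite mcoeff_msupp => nz i; apply/eqP; move: i; apply/forallP.
have := power_form_coef c d v m; case: ifP => // _ /eqP.
by rewrite mulf_eq0 (negbTE nz) (negbTE (natr_prod_fact_neq0 char0 _)).
Qed.

Lemma span_power_formP r (v : 'I_r -> 'I_n -> k) (M : {mpoly k[n]}) :
  multihomog c d M ->
  (exists a : 'I_r -> k, M = \sum_(i < r) a i *: power_form c d (v i)) <->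
  (forall Theta, points_ideal c v Theta -> apolar_ideal M Theta).
Proof.
move=> hM; have GX (F : {mpoly k[n]}) u :
    (exists e, multihomog c e F) /\ (forall i, F.@[v i] = 0) ->
    (exists e, multihomog c e ('X_[u] * F)) /\
    (forall i, ('X_[u] * F).@[v i] = 0).
  move=> [[e he] F0]; split; first by eexists; apply: multihomogXM he.
  by move=> i; rewrite mevalM F0 mulr0.
rewrite /points_ideal (ideal_gen_apolarP char0 hM) //; last by move=> F [].
split=> [[a ->] F hF [_ F0]|H].
  rewrite pairing_lincombr big1 // => i _.
  by rewrite pairing_power_form // F0 !mulr0.
(* The kernel of A, acting on columns, consists of the coefficient vectors of
   the forms of multidegree d that vanish at all the points; it is spanned by
   the columns of [cokermx A], and u is orthogonal to it. *)
pose A : 'M[k]_(r, dimSd c d) := \matrix_(i, a) \prod_(b < n) v i b ^+ mon a b.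
pose u : 'rV[k]_(dimSd c d) := \row_a (M@_(mon a) * (mnm_fact (mon a))%:R).
have /submxP[D uDA] : (u <= A)%MS.
  rewrite submxE; apply/eqP/matrixP => z q; rewrite ord1 {z} mxE [RHS]mxE.
  pose F : {mpoly k[n]} := form_of (fun a => cokermx A a q).
  have hF : multihomog c d F by exact: form_of_homog.
  rewrite -[RHS](H F hF); last first.
    split=> [|i]; first by exists d.
    rewrite mevalE (big_msupp_Sd (c := c) (d := d)); last first.
      by move=> m mF _; apply: hF.
    have /matrixP/(_ i q) := mulmx_coker A; rewrite mxE [RHS]mxE => AK.
    rewrite -[RHS]AK; apply: eq_bigr => a _.
    by rewrite form_of_coef [A _ _]mxE mulrC.
  by apply: eq_bigr => a _; rewrite form_of_coef [u _ _]mxE mulrC.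
have dn0 : dfact%:R != 0 :> k by exact: natr_prod_fact_neq0.
exists (fun i => D ord0 i / dfact%:R).
apply: eq_homog hM _ _ => [|a].
  by apply: multihomog_lincomb => i; apply: power_form_homog.
apply: (mulIf (natr_prod_fact_neq0 char0 (mon a))).
have /matrixP/(_ ord0 a) := uDA; rewrite !mxE => ->.
rewrite raddf_sum mulr_suml; apply: eq_bigr => i _ /=.
rewrite mcoeffZ mxE -mulrA [_ * (_)%:R]mulrC power_form_coef.
have -> : [forall i, multideg c (mon a) i == d i].
  by apply/forallP => j; rewrite multideg_Sd_mon.
by rewrite mulrA divfK.
Qed.

(** * Linear forms on the target of the Segre-Veronese map *)

Lemma segre_veroneseE (b : 'I_(dimSd c d)) :
  segre_veronese k b = (dfact%:R / (mnm_fact (mon b))%:R) *: 'X_[mon b].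
Proof.
have := power_form_coef c d (fun b : 'I_n => 'X_b : {mpoly k[n]}) (mon b).
have -> : [forall i, multideg c (mon b) i == d i].
  by apply/forallP => j; rewrite multideg_Sd_mon.
rewrite -mpolyXE_id -/(segre_veronese k b) !mulr_natl => E.
have nz : (mnm_fact (mon b))%:R != 0 :> k by exact: natr_prod_fact_neq0.
rewrite -[LHS](scalerK nz) scaler_nat E.
by rewrite -(scaler_nat _ 'X_[_]) scalerA mulr_natr.
Qed.

(** L(nu), the pullback of L by the Segre-Veronese map. *)
Definition linear_pull (L : {mpoly k[dimSd c d]}) : {mpoly k[n]} :=
  \sum_(b < dimSd c d) L@_U_(b) *: segre_veronese k b.

Lemma linear_mpolyE N (L : {mpoly k[N]}) :
  multihomog (@one_block N) (fun=> 1%N) L -> L = \sum_(b < N) L@_U_(b) *: 'X_b.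
Proof.
move=> hL; apply/mpolyP => m; rewrite raddf_sum /=.
under eq_bigr do rewrite mcoeffZ mcoeffX.
case: (pickP (fun b => U_(b)%MM == m)) => [b /eqP bm|none].
  rewrite (bigD1 b) //= bm eqxx mulr1 big1 ?addr0 // => e neb.
  case: eqP => [em|_]; last by rewrite mulr0.
  have := mnm1E b e; rewrite bm -em mnm1E eqxx.
  by rewrite (eq_sym b) (negbTE neb).
rewrite big1 => [|b _]; last by rewrite none mulr0.
have [/hL/(_ ord0)|/memN_msupp_eq0//] := boolP (m \in msupp L).
have -> : multideg (@one_block N) m ord0 = mdeg m.
  by rewrite (mdeg_multideg (@one_block N)) big_ord1.
by move/eqP/mdeg1P => [b /eqP mb]; have := none b; rewrite mb eqxx.
Qed.

Lemma linear_pull_homog L : multihomog c d (linear_pull L).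
Proof.
apply: multihomog_lincomb => b m; rewrite segre_veroneseE => /msuppZ_le.
by rewrite msuppX mem_seq1 => /eqP -> i; apply: multideg_Sd_mon.
Qed.

Lemma pairing_linear_pull L M :
  multihomog (@one_block _) (fun=> 1%N) L ->
  pairing c d (linear_pull L) M = dfact%:R * L.@[Sd_coord M].
Proof.
move=> /linear_mpolyE {2}->; rewrite pairing_suml raddf_sum mulr_sumr /=.
apply: eq_bigr => b _; rewrite mevalZ mevalXU segre_veroneseE !pairingZl.
rewrite /pairing (bigD1 b) //= [X in _ + X]big1 => [|a nab].
  rewrite mcoeffX eqxx mul1r addr0 mulrACA mulVf ?natr_prod_fact_neq0 // mulr1.
  exact: mulrCA.
by rewrite mcoeffX (inj_eq (@Sd_mon_inj _ _ c d)) eq_sym (negbTE nab) mul0r.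
Qed.

Lemma linear_pull_onto (F : {mpoly k[n]}) :
  multihomog c d F ->
  exists L, multihomog (@one_block _) (fun=> 1%N) L /\ linear_pull L = F.
Proof.
move=> hF; pose w b := F@_(mon b) * ((mnm_fact (mon b))%:R / dfact%:R).
pose L : {mpoly k[dimSd c d]} := \sum_b w b *: 'X_b.
have Lb b : L@_U_(b) = w b.
  rewrite raddf_sum /= (bigD1 b) //= mcoeffZ mcoeffXU eqxx mulr1.
  rewrite big1 ?addr0 // => e neb.
  by rewrite mcoeffZ mcoeffXU (negbTE neb) mulr0.
exists L; split.
  apply: multihomog_lincomb => b m; rewrite msuppX mem_seq1 => /eqP -> i.
  by rewrite [i]ord1 multidegU.
apply: (eq_homog (@linear_pull_homog L) hF) => a.
rewrite raddf_sum /= (bigD1 a) //= big1 => [|b nba]; rewrite mcoeffZ.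
  rewrite addr0 Lb segre_veroneseE mcoeffZ mcoeffX eqxx mulr1 -mulrA.
  have nz := natr_prod_fact_neq0 char0 (mon a).
  have dn0 : dfact%:R != 0 :> k by exact: natr_prod_fact_neq0.
  by rewrite -[_ / (mnm_fact _)%:R]invf_div mulfV ?mulr1 ?mulf_neq0 ?invr_neq0.
rewrite segre_veroneseE mcoeffZ mcoeffX (inj_eq (@Sd_mon_inj _ _ c d)).
by rewrite (negbTE nba) !mulr0.
Qed.

(** The variables in the product equal 1 on the chart. *)
Lemma absorb_chart_vars (Z : closed_subscheme k c) (K : chart c)
    (e : 'I_s -> nat) (F : {mpoly k[n]}) :
  chart_ideal Z K (\prod_(i < s) chart_var k K i ^+ e i * F) ->
  chart_ideal Z K F.
Proof.
have [_ ID IM] := chart_ideal_ideal Z K.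
pose nzd x := forall G, chart_ideal Z K (x * G) -> chart_ideal Z K G.
have nzdM x y : nzd x -> nzd y -> nzd (x * y).
  by move=> hx hy G; rewrite -mulrA => /hx/hy.
have nzd1 : nzd 1 by move=> G; rewrite mul1r.
have nzd_var i : nzd (chart_var k K i).
  move=> G xG; have -> : G = chart_var k K i * G +
      (- G) * (chart_var k K i - 1).
    by rewrite mulNr mulrBr mulr1 opprB addrCA [G * _]mulrC subrr addr0.
  by apply: ID => //; apply/IM/chart_ideal_slice.
suff: nzd (\prod_(i < s) chart_var k K i ^+ e i) by apply.
apply: (big_ind nzd) => // i _; elim: (e i) => [|p IH]; first by rewrite expr0.
by rewrite exprS; apply: nzdM.
Qed.

Lemma chart_mon (K : chart c) :
  exists a : 'I_(dimSd c d),
    'X_[mon a] = \prod_(i < s) chart_var k K i ^+ d i.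
Proof.
pose m := (\sum_(i < s) (U_(val K i) *+ d i))%MM.
have [|a am] := @Sd_monP _ _ c d m; last first.
  exists a; rewrite am /m (big_morph _ (@mpolyXD _ _) (mpolyX0 _ _)).
  by apply: eq_bigr => i _; rewrite mpolyXn.
move=> i; rewrite /m (big_morph (multideg c ^~ i)
  (fun p q => multidegD c p q i) (multideg0 c i)) (bigD1 i) //=.
have multidegMn u p : multideg c (u *+ p) i = (multideg c u i * p)%N.
  by rewrite /multideg big_distrl; apply: eq_bigr => b _; rewrite mulmnE.
have cK j : c (val K j) = j by apply/eqP; have /forallP := valP K; apply.
rewrite multidegMn multidegU cK eqxx mul1n big1 ?addn0 // => j nij.
by rewrite multidegMn multidegU cK (negbTE nij).
Qed.

(** From left to right, the exponent in the definition of the image ideal is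
    removed on the chart K by choosing the coordinate a of the target to be
    that of the monomial of [chart_mon], so that nu_a is a nonzero constant on
    this chart. *)
Lemma vanishes_on_sv_image (Z : closed_subscheme k c) L :
  multihomog (@one_block _) (fun=> 1%N) L ->
  vanishes_on (sv_image d Z) L <-> vanishes_on Z (linear_pull L).
Proof.
move=> /linear_mpolyE eL.
(* The exponent is m.+1 because an exponent 0 is too small to clear the
   denominator nu_a of a linear form. *)
have pullL a m : sv_pullw a m.+1 L = segre_veronese k a ^+ m * linear_pull L.
  rewrite {1}eL sv_pullw_sum mulr_sumr; apply: eq_bigr => b _.
  rewrite sv_pullwZ sv_pullwX ?mdeg1 // -scalerAr /sv_mon mdeg1 subn1 /=.
  congr (_ *: (_ * _)); rewrite (bigD1 b) //= mnm1E eqxx expr1 big1 ?mulr1 //.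
  by move=> e neb; rewrite mnm1E eq_sym (negbTE neb) expr0.
split=> [vL K|vL J].
  have [a Ka] := chart_mon K.
  have Jc : [forall i, one_block ([ffun=> a] i) == i :> 'I_1].
    by apply/forallP => i; rewrite !ord1.
  have /sv_image_idealP/(_ K) [m [szL]] := vL (Sub [ffun=> a] Jc).
  move=> /(sv_pullw_raise 1 szL); rewrite add1n pullL /= ffunE segre_veroneseE.
  rewrite exprZn Ka -scalerAl -prodrXl.
  set x := _ ^+ m => Hx; apply: (@absorb_chart_vars Z K (fun i => d i * m)%N).
  under eq_bigr do rewrite exprM.
  have [_ _ IM] := chart_ideal_ideal Z K; move: (IM x^-1%:MP _ Hx).
  rewrite mul_mpolyC scalerA mulVf ?scale1r // expf_neq0 //.
  by rewrite mulf_neq0 ?invr_neq0 ?natr_prod_fact_neq0.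
apply/sv_image_idealP => K; exists 1%N; rewrite pullL expr0 mul1r; split=> //.
rewrite eL; apply: leq_trans (msize_sum _ _ _) _.
apply/bigmax_leqP => b _; apply: leq_trans (msizeZ_le _ _) _.
by rewrite msizeX mdeg1.
Qed.

Lemma linear_span_sv_imageP (Z : closed_subscheme k c) (M : {mpoly k[n]}) :
  multihomog c d M ->
  in_linear_span (sv_image d Z) (Sd_coord M) <->
  (forall Theta, scheme_ideal Z Theta -> apolar_ideal M Theta).
Proof.
move=> hM; have GX (F : {mpoly k[n]}) u :
    (exists e, multihomog c e F) /\ vanishes_on Z F ->
    (exists e, multihomog c e ('X_[u] * F)) /\ vanishes_on Z ('X_[u] * F).
  move=> [[e he] F0]; split; first by eexists; apply: multihomogXM he.
  by move=> K; have [_ _ IM] := chart_ideal_ideal Z K; apply/IM/F0.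
rewrite /scheme_ideal (ideal_gen_apolarP char0 hM) //; last by move=> F [].
split=> [H F hF [_ vF]|H L hL vL].
  have [L [hL LF]] := linear_pull_onto hF.
  rewrite -LF pairing_linear_pull // H ?mulr0 //.
  by apply/vanishes_on_sv_image; rewrite ?LF.
have dn0 : dfact%:R != 0 :> k by exact: natr_prod_fact_neq0.
apply: (mulfI dn0); rewrite mulr0 -pairing_linear_pull //.
apply: H; first exact: linear_pull_homog.
split; first by exists d; apply: linear_pull_homog.
exact/vanishes_on_sv_image.
Qed.

End Apolarity.

(** * The multigraded apolarity lemma *)

Theorem theorem4p10 (k : closedFieldType) (char0 : [pchar k] =i pred0)
  (s : nat) (V : 'I_s -> vectType k)
  (B : forall i, (\dim {:V i}).-tuple (V i))
  (basisB : forall i, basis_of {:V i} (B i))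
  (d : 'I_s -> nat) (M : {mpoly k[nvars V]})
  (homM : multihomog (@var_block k s V) d M) (M_neq0 : M != 0) :
  (forall (r : nat) (P : 'I_r -> forall j, V j),
     (forall i j, P i j != 0) ->
     (exists a : 'I_r -> k,
        M = \sum_(i < r)
              a i *: power_form (@var_block k s V) d (point_coord B (P i)))
     <->
     (forall Theta,
        points_ideal (@var_block k s V)
          (fun i : 'I_r => point_coord B (P i)) Theta ->
        apolar_ideal M Theta)) /\
  (forall Z : closed_subscheme k (@var_block k s V),
     in_linear_span (sv_image d Z) (Sd_coord M) <->
     (forall Theta, scheme_ideal Z Theta -> apolar_ideal M Theta)).
Proof.
split=> [r P _|Z]; first exact: span_power_formP.
exact: linear_span_sv_imageP.
Qed.
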